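(* Let $\mathbb{F}$ be a field of characteristic $0$ and let $\alpha\in\mathbb{F}$. Let $\mathcal{F}_\alpha$ be the charged Fock space of charge $\alpha$ with vacuum vector $\mathbf{v}_\alpha$, viewed as a $\mathcal{U}(\mathfrak{vir})$-module through the Sugawara construction, and let $\mathcal{V}_{1,\alpha^2/2}$ be the Virasoro Verma module of central charge $1$ and conformal weight $\frac{\alpha^2}{2}$, with highest weight vector $\mathbf{v}_{1,\alpha^2/2}$. Then there exists a unique homomorphism of $\mathcal{U}(\mathfrak{vir})$-modules $\mathcal{V}_{1,\alpha^2/2}\to\mathcal{F}_\alpha$ such that $\mathbf{v}_{1,\alpha^2/2}\mapsto\mathbf{v}_\alpha$.
   Context: $\mathcal{U}(\mathfrak{g})$ denotes the universal enveloping algebra of a Lie algebra $\mathfrak{g}$; representations of $\mathfrak{g}$ are identified with left $\mathcal{U}(\mathfrak{g})$-modules. Verma modules. Let $\mathfrak{g}=\mathfrak{g}_-\oplus\mathfrak{g}_0\oplus\mathfrak{g}_+$ be a Lie algebra over $\mathbb{F}$ with a triangular decomposition ($\mathfrak{g}_0$ an abelian Lie subalgebra, $\mathfrak{g}_\pm$ Lie subalgebras) and $\lambda\in\mathfrak{g}_0^*$. In a left $\mathcal{U}(\mathfrak{g})$-module $V$, a highest weight vector of highest weight $\lambda$ is a vector $v\in V$ (possibly zero) with $Hv=\lambda(H)v$ for all $H\in\mathfrak{g}_0$ and $Xv=0$ for all $X\in\mathfrak{g}_+$. A Verma module with highest weight $\lambda$ is a left $\mathcal{U}(\mathfrak{g})$-module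 $M$ with a highest weight vector $\mathbf{v}\in M$ of highest weight $\lambda$ such that $M=\mathcal{U}(\mathfrak{g})\mathbf{v}$ and such that for any $\mathcal{U}(\mathfrak{g})$-module $V$ with a highest weight vector $v$ of highest weight $\lambda$ there is a unique $\mathcal{U}(\mathfrak{g})$-module homomorphism $f:M\to V$ with $f(\mathbf{v})=v$. It exists and is unique up to isomorphism; concretely it is $\mathcal{U}(\mathfrak{g})/I_\lambda$, where $I_\lambda$ is the left ideal generated by $H-\lambda(H)1$ ($H\in\mathfrak{g}_0$) and $X$ ($X\in\mathfrak{g}_+$), with $\mathbf{v}=1+I_\lambda$. Virasoro algebra. $\mathfrak{vir}$ has basis $\{\mathcal{L}_n: n\in\mathbb{Z}\}\cup\{C\}$ with brackets $[\mathcal{L}_m,\mathcal{L}_n]=(m-n)\mathcal{L}_{m+n}+\frac{m^3-m}{12}\delta_{m,-n}C$ and $[C,\mathcal{L}_n]=0$. Its triangular decomposition is $\mathfrak{vir}_\pm=\mathrm{span}_{\mathbb{F}}\{\mathcal{L}_n:\pm n>0\}$, $\mathfrak{vir}_0=\mathrm{span}_{\mathbb{F}}\{\mathcal{L}_0,C\}$. For $c,h\in\mathbb{F}$, $\mathcal{V}_{c,h}$ is the Verma module of $\mathfrak{vir}$ with highest weight $\lambda$ given by $\lambda(C)=c$, $\lambda(\mathcal{L}_0)=h$; its highest weight vector is denoted $\mathbf{v}_{c,h}$. Heisenberg algebra. $\mathfrak{hei}$ has basis $\{\mathcal{J}_k: k\in\mathbb{Z}\}\cup\{\mathcal{K}\}$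 with brackets $[\mathcal{J}_k,\mathcal{J}_l]=k\,\delta_{k,-l}\,\mathcal{K}$ and $[\mathcal{K},\mathcal{J}_k]=0$. Its triangular decomposition is $\mathfrak{hei}_\pm=\mathrm{span}_{\mathbb{F}}\{\mathcal{J}_k:\pm k>0\}$, $\mathfrak{hei}_0=\mathrm{span}_{\mathbb{F}}\{\mathcal{J}_0,\mathcal{K}\}$. The charged Fock space $\mathcal{F}_\alpha$ is the Verma module of $\mathfrak{hei}$ with highest weight $\lambda$ given by $\lambda(\mathcal{K})=1$, $\lambda(\mathcal{J}_0)=\alpha$; its highest weight vector $\mathbf{v}_\alpha$ is called the vacuum. Sugawara action on $\mathcal{F}_\alpha$. Let $\mathsf{J}_k$ be the action of $\mathcal{J}_k$ on $\mathcal{F}_\alpha$, and put ${:}\mathsf{J}_k\mathsf{J}_l{:}=\mathsf{J}_k\circ\mathsf{J}_l$ if $k\le l$ and $\mathsf{J}_l\circ\mathsf{J}_k$ if $k>l$. The $\mathcal{U}(\mathfrak{vir})$-module structure on $\mathcal{F}_\alpha$ is the one in which $C$ acts as the identity and $\mathcal{L}_n$ acts as $\mathsf{L}_n$, where $\mathsf{L}_n v=\frac12\sum_{k\in\mathbb{Z}}{:}\mathsf{J}_{n-k}\mathsf{J}_k{:}\,v$ (for each $v$ only finitely many terms are nonzero). *)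

(* Defs.v *)
From HB Require Import structures.
From mathcomp Require Import all_boot all_order all_algebra.
From mathcomp Require Import finmap.
From mathcomp Require Import boolp classical_sets functions cardinality fsbigop.
From mathcomp.multinomials Require Import monalg.
From mathcomp Require Import zify ring.

Set Implicit Arguments.
Unset Strict Implicit.
Unset Printing Implicit Defensive.

Import Order.TTheory GRing.Theory Num.Theory.
Local Open Scope ring_scope.
Local Open Scope quotient_scope.

HB.mixin Record Lmodule_isLie (F : fieldType) L of GRing.Lmodule F L := {
  lie : L -> L -> L;
  lie_linearl : forall (a : F) (x y z : L),
    lie (a *: x + y) z = a *: lie x z + lie y z;
  lie_linearr : forall (a : F) (x y z : L),
    lie z (a *: x + y) = a *: lie z x + lie z y;
  liexx : forall x : L, lie x x = 0;
  lie_jacobi : forall x y z : L,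
    lie x (lie y z) + lie y (lie z x) + lie z (lie x y) = 0
}.

#[short(type="lieAlgType")]
HB.structure Definition LieAlgebra (F : fieldType) :=
  {L of Lmodule_isLie F L & GRing.Lmodule F L}.

Section Enveloping.
Variables (F : fieldType) (g : lieAlgType F).

(* [U g] is the quotient of the set of expressions in scalars and elements of  *)
(* [g] by the smallest congruence that makes it an associative unital          *)
(* [F]-algebra to which [g] maps linearly with [[x, y] = x y - y x].           *)
Inductive uexpr : Type :=
| UConst of F
| UGen of g
| UAdd of uexpr & uexpr
| UMul of uexpr & uexpr.

Inductive ueq : uexpr -> uexpr -> Prop :=
| ueq_refl e : ueq e e
| ueq_sym e1 e2 : ueq e1 e2 -> ueq e2 e1
| ueq_trans e1 e2 e3 : ueq e1 e2 -> ueq e2 e3 -> ueq e1 e3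
| ueq_add e1 e1' e2 e2' :
    ueq e1 e1' -> ueq e2 e2' -> ueq (UAdd e1 e2) (UAdd e1' e2')
| ueq_mul e1 e1' e2 e2' :
    ueq e1 e1' -> ueq e2 e2' -> ueq (UMul e1 e2) (UMul e1' e2')
| ueq_addA e1 e2 e3 : ueq (UAdd e1 (UAdd e2 e3)) (UAdd (UAdd e1 e2) e3)
| ueq_addC e1 e2 : ueq (UAdd e1 e2) (UAdd e2 e1)
| ueq_add0 e : ueq (UAdd (UConst 0) e) e
| ueq_addN e : ueq (UAdd (UMul (UConst (-1)) e) e) (UConst 0)
| ueq_mulA e1 e2 e3 : ueq (UMul e1 (UMul e2 e3)) (UMul (UMul e1 e2) e3)
| ueq_mul1 e : ueq (UMul (UConst 1) e) e
| ueq_mulDl e1 e2 e3 :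
    ueq (UMul (UAdd e1 e2) e3) (UAdd (UMul e1 e3) (UMul e2 e3))
| ueq_mulDr e1 e2 e3 :
    ueq (UMul e1 (UAdd e2 e3)) (UAdd (UMul e1 e2) (UMul e1 e3))
| ueq_constD a b : ueq (UConst (a + b)) (UAdd (UConst a) (UConst b))
| ueq_constM a b : ueq (UConst (a * b)) (UMul (UConst a) (UConst b))
| ueq_constC a e : ueq (UMul (UConst a) e) (UMul e (UConst a))
| ueq_genL a x y :
    ueq (UGen (a *: x + y)) (UAdd (UMul (UConst a) (UGen x)) (UGen y))
| ueq_lie x y :
    ueq (UAdd (UGen (lie x y)) (UMul (UGen y) (UGen x)))
        (UMul (UGen x) (UGen y)).

HB.instance Definition _ := gen_eqMixin uexpr.
HB.instance Definition _ := gen_choiceMixin uexpr.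

Definition ueqb : rel uexpr := fun e1 e2 => `[< ueq e1 e2 >].

Lemma ueqb_equiv : equiv_class_of ueqb.
Proof.
split=> [e|e1 e2|e2 e1 e3].
- by apply/asboolP; exact: ueq_refl.
- by apply/asboolP/asboolP; exact: ueq_sym.
- by move=> /asboolP h1 /asboolP h2; apply/asboolP; apply: ueq_trans h1 h2.
Qed.

Canonical ueqb_equiv_rel := EquivRelPack ueqb_equiv.

Definition U : Type := {eq_quot ueqb}.
HB.instance Definition _ := Choice.copy U {eq_quot ueqb}.
HB.instance Definition _ := Quotient.copy U {eq_quot ueqb}.
HB.instance Definition _ := EqQuotient.copy U {eq_quot ueqb}.

Definition uclass (e : uexpr) : U := \pi_U e.

Lemma uclassP e1 e2 : uclass e1 = uclass e2 <-> ueq e1 e2.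
Proof.
rewrite /uclass; split.
  by move/eqP; rewrite eqmodE => /asboolP.
by move=> h; apply/eqP; rewrite eqmodE; apply/asboolP.
Qed.

Lemma uclass_repr u : uclass (repr u) = u.
Proof. exact: reprK. Qed.

Lemma U_ind (P : U -> Prop) : (forall e, P (uclass e)) -> forall u, P u.
Proof. by move=> h u; rewrite -(uclass_repr u). Qed.

Lemma repr_uclass e : ueq (repr (uclass e)) e.
Proof. by apply/uclassP; rewrite uclass_repr. Qed.

Definition uadd (u v : U) : U := uclass (UAdd (repr u) (repr v)).
Definition umul (u v : U) : U := uclass (UMul (repr u) (repr v)).
Definition uconst (a : F) : U := uclass (UConst a).
Definition uopp (u : U) : U := umul (uconst (-1)) u.

Lemma uaddE e1 e2 : uadd (uclass e1) (uclass e2) = uclass (UAdd e1 e2).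
Proof. by apply/uclassP/ueq_add; exact: repr_uclass. Qed.

Lemma umulE e1 e2 : umul (uclass e1) (uclass e2) = uclass (UMul e1 e2).
Proof. by apply/uclassP/ueq_mul; exact: repr_uclass. Qed.

Let E := (uaddE, umulE).

Lemma uaddA : associative uadd.
Proof.
elim/U_ind=> x; elim/U_ind=> y; elim/U_ind=> z.
by rewrite !E; apply/uclassP; constructor.
Qed.
Lemma uaddC : commutative uadd.
Proof.
by elim/U_ind=> x; elim/U_ind=> y; rewrite !E; apply/uclassP; constructor.
Qed.
Lemma uadd0 : left_id (uconst 0) uadd.
Proof. by elim/U_ind=> x; rewrite !E; apply/uclassP; constructor. Qed.
Lemma uaddN : left_inverse (uconst 0) uopp uadd.
Proof. by elim/U_ind=> x; rewrite /uopp /uconst !E; apply/uclassP; constructor. Qed.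

HB.instance Definition _ := GRing.isZmodule.Build U uaddA uaddC uadd0 uaddN.

Lemma umulA : associative umul.
Proof.
elim/U_ind=> x; elim/U_ind=> y; elim/U_ind=> z.
by rewrite !E; apply/uclassP; constructor.
Qed.
Lemma uconstC a u : umul (uconst a) u = umul u (uconst a).
Proof. by elim/U_ind: u => u; rewrite !E; apply/uclassP; constructor. Qed.
Lemma umul1 : left_id (uconst 1) umul.
Proof. by elim/U_ind=> x; rewrite !E; apply/uclassP; constructor. Qed.
Lemma umulr1 : right_id (uconst 1) umul.
Proof. by move=> x; rewrite -uconstC umul1. Qed.
Lemma umulDl : left_distributive umul uadd.
Proof.
elim/U_ind=> x; elim/U_ind=> y; elim/U_ind=> z.
by rewrite !E; apply/uclassP; constructor.
Qed.
Lemma umulDr : right_distributive umul uadd.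
Proof.
elim/U_ind=> x; elim/U_ind=> y; elim/U_ind=> z.
by rewrite !E; apply/uclassP; constructor.
Qed.

(* The augmentation, used only to see that [U g] is not the zero ring. *)
Fixpoint ucounit (e : uexpr) : F :=
  match e with
  | UConst a => a
  | UGen _ => 0
  | UAdd e1 e2 => ucounit e1 + ucounit e2
  | UMul e1 e2 => ucounit e1 * ucounit e2
  end.

Lemma ucounitP e1 e2 : ueq e1 e2 -> ucounit e1 = ucounit e2.
Proof.
by elim=> //=; intros; try congruence; try ring.
Qed.

Lemma uconst10 : uconst 1 != uconst 0.
Proof.
apply/negP=> /eqP/uclassP/ucounitP /= /eqP.
by rewrite oner_eq0.
Qed.

HB.instance Definition _ := GRing.Zmodule_isNzRing.Build U
  umulA umul1 umulr1 umulDl umulDr uconst10.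

Definition uscale (a : F) (u : U) : U := umul (uconst a) u.

Lemma uscaleA a b u : uscale a (uscale b u) = uscale (a * b) u.
Proof.
rewrite /uscale umulA; congr umul; rewrite umulE.
by apply/uclassP/ueq_sym; constructor.
Qed.
Lemma uscale1 : left_id 1 uscale.
Proof. exact: umul1. Qed.
Lemma uscaleDr : right_distributive uscale +%R.
Proof. by move=> a u v; rewrite /uscale; exact: umulDr. Qed.
Lemma uscaleDl u : {morph uscale^~ u : a b / a + b}.
Proof.
move=> a b; rewrite /uscale.
have -> : uconst (a + b) = uadd (uconst a) (uconst b).
  by rewrite uaddE; apply/uclassP; constructor.
exact: umulDl.
Qed.

HB.instance Definition _ :=
  GRing.Zmodule_isLmodule.Build F U uscaleA uscale1 uscaleDr uscaleDl.

Lemma uscaleAl (a : F) (u v : U) : a *: (u * v) = (a *: u) * v.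
Proof. exact: umulA. Qed.
HB.instance Definition _ := GRing.Lmodule_isLalgebra.Build F U uscaleAl.
Lemma uscaleAr (a : F) (u v : U) : a *: (u * v) = u * (a *: v).
Proof.
rewrite [LHS]umulA [umul _ u]uconstC; symmetry; exact: umulA.
Qed.
HB.instance Definition _ := GRing.Lalgebra_isAlgebra.Build F U uscaleAr.

Definition ugen (x : g) : U := uclass (UGen x).

Lemma uconstE a : uconst a = a%:A.
Proof. by symmetry; exact: umulr1. Qed.

Lemma uclass_const a : uclass (UConst a) = a%:A.
Proof. exact: uconstE. Qed.
Lemma uclass_gen x : uclass (UGen x) = ugen x.
Proof. by []. Qed.
Lemma uclass_add e1 e2 : uclass (UAdd e1 e2) = uclass e1 + uclass e2.
Proof. by symmetry; exact: uaddE. Qed.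
Lemma uclass_mul e1 e2 : uclass (UMul e1 e2) = uclass e1 * uclass e2.
Proof. by symmetry; exact: umulE. Qed.

Lemma ugen_is_linear : linear ugen.
Proof.
move=> a x y; rewrite /ugen.
have /uclassP -> := ueq_genL a x y.
by rewrite uclass_add uclass_mul uclass_const mulr_algl.
Qed.
HB.instance Definition _ := GRing.isLinear.Build F g U *:%R ugen ugen_is_linear.

Lemma ugen_lie x y : ugen (lie x y) = ugen x * ugen y - ugen y * ugen x.
Proof.
apply/eqP; rewrite eq_sym subr_eq eq_sym; apply/eqP.
by have /uclassP := ueq_lie x y; rewrite uclass_add !uclass_mul.
Qed.

Lemma U_rec (P : U -> Prop) :
  (forall a, P a%:A) -> (forall x, P (ugen x)) ->
  (forall u v, P u -> P v -> P (u + v)) ->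
  (forall u v, P u -> P v -> P (u * v)) -> forall u, P u.
Proof.
move=> hc hg ha hm; elim/U_ind; elim=> [a|x|e1 h1 e2 h2|e1 h1 e2 h2].
- by rewrite uclass_const.
- exact: hg.
- by rewrite uclass_add; exact: ha.
- by rewrite uclass_mul; exact: hm.
Qed.

End Enveloping.

(* A [U g]-module with its scalars restricted along [F -> U g]. *)
Section Restriction.
Variables (F : fieldType) (g : lieAlgType F) (M : lmodType (U g)).

Definition restr : Type := M.
HB.instance Definition _ := GRing.Zmodule.copy restr M.

Definition rscale (a : F) (x : restr) : restr := (a%:A : U g) *: (x : M).

Lemma rscaleA a b x : rscale a (rscale b x) = rscale (a * b) x.
Proof. by rewrite /rscale scalerA -scalerAl mul1r scalerA. Qed.
Lemma rscale1 : left_id 1 rscale.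
Proof. by move=> x; rewrite /rscale scale1r; exact: scale1r. Qed.
Lemma rscaleDr : right_distributive rscale +%R.
Proof. by move=> a x y; exact: scalerDr. Qed.
Lemma rscaleDl x : {morph rscale^~ x : a b / a + b}.
Proof. by move=> a b; rewrite /rscale scalerDl; exact: scalerDl. Qed.

HB.instance Definition _ :=
  GRing.Zmodule_isLmodule.Build F restr rscaleA rscale1 rscaleDr rscaleDl.

Lemma restrZ (a : F) (x : restr) : a *: x = (a%:A : U g) *: (x : M).
Proof. by []. Qed.

Lemma restr_comm (a : F) (u : U g) (x : M) :
  u *: (a *: (x : restr) : M) = a *: (u *: x : restr).
Proof. by rewrite !restrZ !scalerA mulr_algl mulr_algr. Qed.

Lemma restr_scalel (a : F) (u : U g) (x : M) :
  (a *: u) *: x = a *: (u *: x : restr).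
Proof. by rewrite restrZ scalerA mulr_algl. Qed.

End Restriction.

Section Representations.
Variables (F : fieldType) (g : lieAlgType F).

Record lieRep (W : lmodType F) := LieRep {
  rep :> g -> W -> W;
  rep_linearl : forall w, linear (rep^~ w);
  rep_linearr : forall x, linear (rep x);
  rep_lie : forall x y w, rep (lie x y) w = rep x (rep y w) - rep y (rep x w)
}.

Variables (W : lmodType F) (r : lieRep W).

Fixpoint ueval (e : uexpr g) (w : W) : W :=
  match e with
  | UConst a => a *: w
  | UGen x => r x w
  | UAdd e1 e2 => ueval e1 w + ueval e2 w
  | UMul e1 e2 => ueval e1 (ueval e2 w)
  end.

Lemma ueval_linear e : linear (ueval e).
Proof.
elim: e => [b|x|e1 h1 e2 h2|e1 h1 e2 h2] a u v /=.
- by rewrite scalerDr !scalerA mulrC.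
- exact: rep_linearr.
- by rewrite h1 h2 scalerDr addrACA.
- by rewrite h2 h1.
Qed.

Lemma uevalD e u v : ueval e (u + v) = ueval e u + ueval e v.
Proof. by rewrite -[u]scale1r ueval_linear !scale1r. Qed.

Lemma ueval0 e : ueval e 0 = 0.
Proof. by apply: (addrI (ueval e 0)); rewrite -uevalD !addr0. Qed.

Lemma uevalZ e a u : ueval e (a *: u) = a *: ueval e u.
Proof. by rewrite -[a *: u]addr0 ueval_linear ueval0 addr0. Qed.

Lemma ueval_ueq e1 e2 : ueq e1 e2 -> ueval e1 =1 ueval e2.
Proof.
elim=> //=.
- by move=> ? ? _ h w; rewrite h.
- by move=> ? ? ? _ h _ h' w; rewrite h.
- by move=> ? ? ? ? _ h _ h' w; rewrite h h'.
- by move=> ? ? ? ? _ h _ h' w; rewrite h h'.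
- by move=> * w; exact: addrA.
- by move=> * w; exact: addrC.
- by move=> * w; rewrite scale0r add0r.
- by move=> * w; rewrite scale0r scaleN1r addNr.
- by move=> * w; rewrite scale1r.
- by move=> * w; rewrite uevalD.
- by move=> * w; rewrite scalerDl.
- by move=> * w; rewrite scalerA.
- by move=> * w; rewrite uevalZ.
- by move=> * w; rewrite rep_linearl.
- by move=> * w; rewrite rep_lie subrK.
Qed.

(* The [U g]-module structure on [W] that extends the representation [r]. *)
Definition Umod of lieRep W : Type := W.
HB.instance Definition _ := GRing.Zmodule.copy (Umod r) W.

Definition uact (u : U g) (w : Umod r) : Umod r := ueval (repr u) w.

Lemma uactE e w : uact (uclass e) w = ueval e w.
Proof. exact/ueval_ueq/repr_uclass. Qed.

Lemma uactA u v w : uact u (uact v w) = uact (u * v) w.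
Proof.
elim/U_ind: u => e1; elim/U_ind: v => e2.
by rewrite -uclass_mul !uactE.
Qed.
Lemma uact1 : left_id 1 uact.
Proof. by move=> w; rewrite (uactE (UConst g 1)) /= scale1r. Qed.
Lemma uactDr : right_distributive uact +%R.
Proof. by elim/U_ind=> e u v; rewrite !uactE uevalD. Qed.
Lemma uactDl w : {morph uact^~ w : u v / u + v}.
Proof.
move=> u v; elim/U_ind: u => e1; elim/U_ind: v => e2.
by rewrite -uclass_add !uactE.
Qed.

HB.instance Definition _ :=
  GRing.Zmodule_isLmodule.Build (U g) (Umod r) uactA uact1 uactDr uactDl.

Lemma Umod_gen (x : g) (w : Umod r) : ugen x *: w = r x w.
Proof. exact: (uactE (UGen x)). Qed.

Lemma Umod_const (a : F) (w : Umod r) :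
  (a%:A : U g) *: w = a *: (w : W).
Proof. by rewrite -uclass_const; exact: (uactE (UConst g a)). Qed.

End Representations.

Section Verma.
Variables (F : fieldType) (g : lieAlgType F).

Definition lie_subalgebra (A : set g) :=
  [/\ A 0, forall a x y, A x -> A y -> A (a *: x + y)
    & forall x y, A x -> A y -> A (lie x y)].

Record triangular := Triangular {
  tri_neg : set g;
  tri_zero : set g;
  tri_pos : set g;
  tri_neg_sub : lie_subalgebra tri_neg;
  tri_zero_sub : lie_subalgebra tri_zero;
  tri_pos_sub : lie_subalgebra tri_pos;
  tri_zero_abelian : forall x y, tri_zero x -> tri_zero y -> lie x y = 0;
  tri_sum : forall x, exists a b c,
    [/\ tri_neg a, tri_zero b, tri_pos c & x = a + b + c];
  tri_direct : forall a b c, tri_neg a -> tri_zero b -> tri_pos c ->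
    a + b + c = 0 -> [/\ a = 0, b = 0 & c = 0]
}.

Variable T : triangular.

(* A weight is given as a linear form on [g], of which only the restriction to *)
(* [tri_zero T] is used.                                                       *)
Definition highest_weight_vector (lam : {scalar g}) (V : lmodType (U g))
    (v : V) :=
  (forall H, tri_zero T H -> ugen H *: v = ((lam H)%:A : U g) *: v) /\
  (forall X, tri_pos T X -> ugen X *: v = 0).

Definition is_verma (lam : {scalar g}) (M : lmodType (U g)) (v : M) :=
  [/\ highest_weight_vector lam v,
      forall x : M, exists u : U g, x = u *: v
    & forall (V : lmodType (U g)) (w : V), highest_weight_vector lam w ->
        exists f : {linear M -> V},
          f v = w /\ forall f' : {linear M -> V}, f' v = w -> f' =1 f].

(* Existence: the quotient of [U g] by the left ideal [vermaI].                *)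
Variable lam : {scalar g}.

Inductive vermaI : U g -> Prop :=
| vermaI0 : vermaI 0
| vermaI_add u v : vermaI u -> vermaI v -> vermaI (u + v)
| vermaI_mul u v : vermaI v -> vermaI (u * v)
| vermaI_zero H : tri_zero T H -> vermaI (ugen H - (lam H)%:A)
| vermaI_pos X : tri_pos T X -> vermaI (ugen X).

Lemma vermaI_opp u : vermaI u -> vermaI (- u).
Proof. by move=> h; rewrite -mulN1r; exact: vermaI_mul. Qed.

Definition vermab : rel (U g) := fun u v => `[< vermaI (u - v) >].

Lemma vermab_equiv : equiv_class_of vermab.
Proof.
split=> [u|u v|v u w].
- by apply/asboolP; rewrite subrr; exact: vermaI0.
- by apply/asboolP/asboolP => /vermaI_opp; rewrite opprB.
- move=> /asboolP h1 /asboolP h2; apply/asboolP.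
  by rewrite -(subrK v u) -addrA; exact: vermaI_add.
Qed.

Canonical vermab_equiv_rel := EquivRelPack vermab_equiv.

Definition verma : Type := {eq_quot vermab}.
HB.instance Definition _ := Choice.copy verma {eq_quot vermab}.
HB.instance Definition _ := Quotient.copy verma {eq_quot vermab}.
HB.instance Definition _ := EqQuotient.copy verma {eq_quot vermab}.

Definition vcl (u : U g) : verma := \pi_verma u.

Lemma vclP u v : vcl u = vcl v <-> vermaI (u - v).
Proof.
rewrite /vcl; split.
  by move/eqP; rewrite eqmodE => /asboolP.
by move=> h; apply/eqP; rewrite eqmodE; apply/asboolP.
Qed.

Lemma vcl_repr x : vcl (repr x) = x.
Proof. exact: reprK. Qed.

Lemma verma_ind (P : verma -> Prop) : (forall u, P (vcl u)) -> forall x, P x.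
Proof. by move=> h x; rewrite -(vcl_repr x). Qed.

Lemma repr_vcl u : vermaI (repr (vcl u) - u).
Proof. by apply/vclP; rewrite vcl_repr. Qed.

Definition vadd (x y : verma) := vcl (repr x + repr y).
Definition vscale (u : U g) (x : verma) := vcl (u * repr x).
Definition vopp (x : verma) := vscale (-1) x.

Lemma vaddE u v : vadd (vcl u) (vcl v) = vcl (u + v).
Proof.
apply/vclP; rewrite opprD addrACA; apply: vermaI_add; exact: repr_vcl.
Qed.
Lemma vscaleE u v : vscale u (vcl v) = vcl (u * v).
Proof.
by apply/vclP; rewrite -mulrBr; apply: vermaI_mul; exact: repr_vcl.
Qed.

Lemma vaddA : associative vadd.
Proof.
elim/verma_ind=> x; elim/verma_ind=> y; elim/verma_ind=> z.
by rewrite !vaddE addrA.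
Qed.
Lemma vaddC : commutative vadd.
Proof.
by elim/verma_ind=> x; elim/verma_ind=> y; rewrite !vaddE addrC.
Qed.
Lemma vadd0 : left_id (vcl 0) vadd.
Proof. by elim/verma_ind=> x; rewrite !vaddE add0r. Qed.
Lemma vaddN : left_inverse (vcl 0) vopp vadd.
Proof. by elim/verma_ind=> x; rewrite /vopp vscaleE vaddE mulN1r addNr. Qed.

HB.instance Definition _ := GRing.isZmodule.Build verma vaddA vaddC vadd0 vaddN.

Lemma vscaleA u v x : vscale u (vscale v x) = vscale (u * v) x.
Proof. by elim/verma_ind: x => x; rewrite !vscaleE mulrA. Qed.
Lemma vscale1 : left_id 1 vscale.
Proof. by elim/verma_ind=> x; rewrite vscaleE mul1r. Qed.
Lemma vscaleDr : right_distributive vscale +%R.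
Proof.
move=> u; elim/verma_ind=> x; elim/verma_ind=> y.
by rewrite [_ + vcl y]vaddE !vscaleE [RHS]vaddE mulrDr.
Qed.
Lemma vscaleDl x : {morph vscale^~ x : u v / u + v}.
Proof.
by move=> u v; elim/verma_ind: x => x; rewrite !vscaleE [RHS]vaddE mulrDl.
Qed.

HB.instance Definition _ :=
  GRing.Zmodule_isLmodule.Build (U g) verma vscaleA vscale1 vscaleDr vscaleDl.

Section VermaHom.
Variables (V : lmodType (U g)) (w : V).
Hypothesis hw : highest_weight_vector lam w.

Lemma vermaI_kill u : vermaI u -> u *: w = 0.
Proof.
elim=> [|a b _ ha _ hb|a b _ hb|H hH|X hX].
- by rewrite scale0r.
- by rewrite scalerDl ha hb addr0.
- by rewrite -scalerA hb scaler0.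
- by rewrite scalerBl hw.1 // subrr.
- exact: hw.2.
Qed.

Definition verma_hom (x : verma) : V := repr x *: w.

Lemma verma_homE u : verma_hom (vcl u) = u *: w.
Proof.
by apply/eqP; rewrite -subr_eq0 -scalerBl vermaI_kill //; exact: repr_vcl.
Qed.

Lemma verma_hom_linear : linear verma_hom.
Proof.
move=> u; elim/verma_ind=> x; elim/verma_ind=> y.
have -> : u *: vcl x + vcl y = vcl (u * x + y).
  by rewrite [u *: _]vscaleE; exact: vaddE.
by rewrite !verma_homE scalerDl scalerA.
Qed.
End VermaHom.

Lemma verma_is_verma : is_verma lam (vcl 1 : verma).
Proof.
have scE (u v : U g) : u *: vcl v = vcl (u * v) by exact: vscaleE.
have gen (x : verma) : x = repr x *: vcl 1 by rewrite scE mulr1 vcl_repr.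
split.
- split=> [H hH|X hX]; rewrite !scE !mulr1; apply/vclP.
    exact: vermaI_zero.
  by rewrite subr0; exact: vermaI_pos.
- by move=> x; exists (repr x).
- move=> V w hw.
  pose fL := GRing.isLinear.Build (U g) verma V *:%R _ (verma_hom_linear hw).
  pose f : {linear verma -> V} := HB.pack (verma_hom w) fL.
  exists f; split; first by rewrite /= verma_homE // scale1r.
  move=> f' hf' x /=; rewrite {1}(gen x) linearZ /= hf'.
  by [].
Qed.

End Verma.

Section Bilinear.
Variables (F : fieldType) (K : Type) (A : lmodType F) (e : K -> A).
Hypothesis e_ind : forall P : A -> Prop, P 0 ->
  (forall a k x, P x -> P (a *: e k + x)) -> forall x, P x.
Variable l : A -> A -> A.
Hypothesis l_linearl : forall a x y z, l (a *: x + y) z = a *: l x z + l y z.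
Hypothesis l_linearr : forall a x y z, l z (a *: x + y) = a *: l z x + l z y.

Lemma bilinDl x y z : l (x + y) z = l x z + l y z.
Proof. by rewrite -[x]scale1r l_linearl !scale1r. Qed.
Lemma bilin0l z : l 0 z = 0.
Proof. by apply: (addrI (l 0 z)); rewrite -bilinDl !addr0. Qed.
Lemma bilinZl a x z : l (a *: x) z = a *: l x z.
Proof. by rewrite -[a *: x]addr0 l_linearl bilin0l addr0. Qed.
Lemma bilinDr z x y : l z (x + y) = l z x + l z y.
Proof. by rewrite -[x]scale1r l_linearr !scale1r. Qed.
Lemma bilin0r z : l z 0 = 0.
Proof. by apply: (addrI (l z 0)); rewrite -bilinDr !addr0. Qed.
Lemma bilinZr a z x : l z (a *: x) = a *: l z x.
Proof. by rewrite -[a *: x]addr0 l_linearr bilin0r addr0. Qed.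

Let lE := (bilinDl, bilinDr, bilinZl, bilinZr, bilin0l, bilin0r).

Lemma bilin_anti x y : (forall i j, l (e i) (e j) = - l (e j) (e i)) ->
  l x y = - l y x.
Proof.
move=> h; elim/e_ind: x => [|a i x hx]; first by rewrite !lE oppr0.
rewrite !lE opprD hx; congr (_ + _).
rewrite -scalerN; congr (_ *: _); clear x hx.
elim/e_ind: y => [|b j y hy]; first by rewrite !lE oppr0.
by rewrite !lE opprD hy h scalerN.
Qed.

Lemma bilin_xx x : (forall i, l (e i) (e i) = 0) ->
  (forall i j, l (e i) (e j) = - l (e j) (e i)) -> l x x = 0.
Proof.
move=> h0 h; elim/e_ind: x => [|a i x hx]; first by rewrite lE.
rewrite !lE hx h0 !scaler0 addr0 add0r.
by rewrite -scalerDr (bilin_anti x) // addrN scaler0.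
Qed.

Lemma bilin_jacobi x y z :
  (forall i j k, l (e i) (l (e j) (e k)) + l (e j) (l (e k) (e i)) +
     l (e k) (l (e i) (e j)) = 0) ->
  l x (l y z) + l y (l z x) + l z (l x y) = 0.
Proof.
move=> hJ; have comb a (x1 x2 x3 y1 y2 y3 : A) :
    (a *: x1 + y1) + (a *: x2 + y2) + (a *: x3 + y3) =
    a *: (x1 + x2 + x3) + (y1 + y2 + y3).
  rewrite (addrACA (a *: x1) y1) (addrACA (_ + a *: x2) _ (a *: x3)).
  by rewrite -!scalerDr.
elim/e_ind: x => [|a i x hx]; first by rewrite !lE !addr0.
rewrite !lE comb hx addr0; clear x hx.
elim/e_ind: y => [|b j y hy]; first by rewrite !lE !addr0 scaler0.
rewrite !lE comb scalerDr hy addr0; clear y hy.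
elim/e_ind: z => [|c k z hz]; first by rewrite !lE !addr0 !scaler0.
by rewrite !lE comb 2!scalerDr hz addr0 hJ !scaler0.
Qed.

End Bilinear.

Section StructureConstants.
Variables (F : fieldType) (K : choiceType).
Local Notation A := {malg F[K]}.

Lemma malg_lin_ind (P : A -> Prop) : P 0 ->
  (forall a k x, P x -> P (a *: << k >> + x)) -> forall x, P x.
Proof.
move=> h0 hD x; rewrite [x]monalgE.
elim/big_rec: _ => [//|k y _ hy].
have -> : << x@_k *g k >> = x@_k *: << k >> :> A; last exact: hD.
by apply/malgP => l; rewrite mcoeffZ !mcoeffU mulrnAr mulr1.
Qed.

Definition lin_ext (V : lmodType F) (f : K -> V) (x : A) : V :=
  \sum_(k <- msupp x) x@_k *: f k.

Lemma lin_extEw (V : lmodType F) (f : K -> V) (x : A) (d : {fset K}) :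
  (msupp x `<=` d)%fset -> lin_ext f x = \sum_(k <- d) x@_k *: f k.
Proof.
move=> le; rewrite /lin_ext (big_fset_incl _ le) // => k _ kx.
by rewrite mcoeff_outdom // scale0r.
Qed.

Lemma lin_ext_is_linear (V : lmodType F) (f : K -> V) : linear (lin_ext f).
Proof.
move=> a x y; pose d := (msupp x `|` msupp y)%fset.
have hx : (msupp x `<=` d)%fset by exact: fsubsetUl.
have hy : (msupp y `<=` d)%fset by exact: fsubsetUr.
have hxy : (msupp (a *: x + y) `<=` d)%fset.
  apply: fsubset_trans (msuppD_le _ _) _; apply: fsetSU; exact: msuppZ_le.
rewrite (lin_extEw _ hx) (lin_extEw _ hy) (lin_extEw _ hxy) scaler_sumr.
rewrite -big_split /=; apply: eq_bigr => k _.
by rewrite mcoeffD mcoeffZ scalerDl scalerA.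
Qed.
HB.instance Definition _ (V : lmodType F) (f : K -> V) :=
  GRing.isLinear.Build F A V *:%R (lin_ext f) (lin_ext_is_linear f).

Lemma lin_extU (V : lmodType F) (f : K -> V) k : lin_ext f << k >> = f k.
Proof.
rewrite (@lin_extEw V f _ [fset k]%fset); last exact: msuppU_le.
by rewrite big_seq_fset1 mcoeffUU scale1r.
Qed.

Lemma lin_ext_funD (V : lmodType F) (f g h : K -> V) a x :
  (forall k, f k = a *: g k + h k) -> lin_ext f x = a *: lin_ext g x + lin_ext h x.
Proof.
move=> e; rewrite /lin_ext scaler_sumr -big_split; apply: eq_bigr => k _ /=.
by rewrite e scalerDr !scalerA mulrC.
Qed.

Lemma eq_lin_ext (V : lmodType F) (f g : K -> V) : f =1 g -> lin_ext f =1 lin_ext g.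
Proof. by move=> e x; apply: eq_bigr => k _; rewrite e. Qed.

Lemma lin_ext0 (V : lmodType F) x : lin_ext (fun _ => 0 : V) x = 0.
Proof. by rewrite /lin_ext big1 // => k _; rewrite scaler0. Qed.

(* The bilinear extension of the table [br] of brackets of basis vectors.      *)
Variable br : K -> K -> A.

Definition sc_lie (x y : A) : A := lin_ext (fun i => lin_ext (br i) y) x.

Lemma sc_lie_linearl a x y z : sc_lie (a *: x + y) z = a *: sc_lie x z + sc_lie y z.
Proof. exact: linearP. Qed.

Lemma sc_lie_linearr a x y z : sc_lie z (a *: x + y) = a *: sc_lie z x + sc_lie z y.
Proof. by apply: lin_ext_funD => k; rewrite linearP. Qed.

Lemma sc_lieU i j : sc_lie << i >> << j >> = br i j.
Proof. by rewrite /sc_lie !lin_extU. Qed.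

Lemma sc_lieU2 i j k a b :
  sc_lie << i >> (a *: << j >> + b *: << k >>) = a *: br i j + b *: br i k.
Proof. by rewrite sc_lie_linearr (bilinZr sc_lie_linearr) !sc_lieU. Qed.

Lemma sc_lieU1 i j a : sc_lie << i >> (a *: << j >>) = a *: br i j.
Proof. by rewrite (bilinZr sc_lie_linearr) sc_lieU. Qed.

Lemma sc_lieU0 i : sc_lie << i >> 0 = 0.
Proof. exact: bilin0r sc_lie_linearr _. Qed.

Hypothesis br_ii : forall i, br i i = 0.
Hypothesis br_anti : forall i j, br i j = - br j i.
Hypothesis br_jacobi : forall i j k,
  sc_lie << i >> (br j k) + sc_lie << j >> (br k i) + sc_lie << k >> (br i j) = 0.

Lemma sc_liexx x : sc_lie x x = 0.
Proof.
apply: (bilin_xx malg_lin_ind sc_lie_linearl sc_lie_linearr) => [i|i j].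
  by rewrite sc_lieU br_ii.
by rewrite !sc_lieU.
Qed.

Lemma sc_lie_jacobi x y z :
  sc_lie x (sc_lie y z) + sc_lie y (sc_lie z x) + sc_lie z (sc_lie x y) = 0.
Proof.
apply: (bilin_jacobi malg_lin_ind sc_lie_linearl sc_lie_linearr) => i j k.
by rewrite !sc_lieU.
Qed.

End StructureConstants.

Section Span.
Variables (F : fieldType) (K : choiceType).

(* The span of the basis vectors indexed by [P]. *)
Definition basis_span (P : pred K) : set {malg F[K]} :=
  [set x | forall k, k \in msupp x -> P k].

Lemma basis_spanP P (x : {malg F[K]}) :
  basis_span P x <-> forall k, ~~ P k -> x@_k = 0.
Proof.
split=> h k; last by rewrite -mcoeff_neq0; apply: contraTT => /h ->; rewrite eqxx.
by move=> nP; apply/mcoeff_outdom/negP => /h; rewrite (negbTE nP).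
Qed.

Lemma basis_span_lin P a (x y : {malg F[K]}) :
  basis_span P x -> basis_span P y -> basis_span P (a *: x + y).
Proof.
move=> /basis_spanP hx /basis_spanP hy; apply/basis_spanP => k nP.
by rewrite mcoeffD mcoeffZ hx // hy // mulr0 addr0.
Qed.

Lemma basis_span0 P : basis_span P 0.
Proof. by apply/basis_spanP => k _; rewrite mcoeff0. Qed.

Lemma basis_spanU (P : pred K) a k : P k -> basis_span P (a *: << k >>).
Proof.
move=> Pk; apply/basis_spanP => l nP; rewrite mcoeffZ mcoeffU.
by case: eqP => [e|]; rewrite ?mulr0 //; rewrite e (negbTE nP) in Pk.
Qed.

Lemma basis_span_lin_ext (P Q : pred K) (f : K -> {malg F[K]}) x :
  (forall i, P i -> basis_span Q (f i)) -> basis_span P x ->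
  basis_span Q (lin_ext f x).
Proof.
move=> hf hx; rewrite /lin_ext big_seq.
elim/big_rec: _ => [|k y ky hy]; first exact: basis_span0.
by apply: basis_span_lin => //; apply/hf/hx.
Qed.

Lemma basis_span_lie (P : pred K) br x y :
  (forall i j, P i -> P j -> basis_span P (br i j)) ->
  basis_span P x -> basis_span P y -> basis_span P (sc_lie br x y).
Proof.
move=> hbr hx hy; apply: (basis_span_lin_ext _ hx) => i Pi.
by apply: (basis_span_lin_ext _ hy) => j Pj; exact: hbr.
Qed.

Lemma basis_span_lie0 (P : pred K) br (x y : {malg F[K]}) :
  (forall i j, P i -> P j -> br i j = 0) ->
  basis_span P x -> basis_span P y -> sc_lie br x y = 0.
Proof.
move=> hbr hx hy; rewrite /sc_lie /lin_ext big_seq big1 // => i ix.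
rewrite big_seq big1 ?scaler0 // => j jy.
by rewrite hbr ?scaler0 //; [apply: hx | apply: hy].
Qed.

Definition basis_proj (P : pred K) (x : {malg F[K]}) : {malg F[K]} :=
  lin_ext (fun k => (P k)%:R *: << k >>) x.

Lemma basis_proj_coeff P x k : (basis_proj P x)@_k = (P k)%:R * x@_k.
Proof.
rewrite /basis_proj; elim/malg_lin_ind: x => [|a l x hx].
  by rewrite linear0 mcoeff0 mulr0.
rewrite linearP /= lin_extU !mcoeffD hx !mcoeffZ !mcoeffU mulrDr; congr (_ + _).
by case: eqP => [->|]; rewrite ?mulr0 // !mulr1 mulrC.
Qed.

Lemma basis_proj_span P x : basis_span P (basis_proj P x).
Proof.
by apply/basis_spanP => k /negbTE nP; rewrite basis_proj_coeff nP mul0r.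
Qed.

Lemma basis_decomp (P1 P2 P3 : pred K) (x : {malg F[K]}) :
  (forall k, (P1 k + P2 k + P3 k = 1)%N) ->
  exists a b c, [/\ basis_span P1 a, basis_span P2 b, basis_span P3 c
    & x = a + b + c].
Proof.
move=> hP; exists (basis_proj P1 x), (basis_proj P2 x), (basis_proj P3 x).
split; try exact: basis_proj_span.
apply/malgP => k; rewrite !mcoeffD !basis_proj_coeff -!mulrDl -!natrD hP.
by rewrite mul1r.
Qed.

Lemma basis_direct (P1 P2 P3 : pred K) (a b c : {malg F[K]}) :
  (forall k, (P1 k + P2 k + P3 k = 1)%N) ->
  basis_span P1 a -> basis_span P2 b -> basis_span P3 c ->
  a + b + c = 0 -> [/\ a = 0, b = 0 & c = 0].
Proof.
move=> hP /basis_spanP ha /basis_spanP hb /basis_spanP hc e.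
have ek k : a@_k + b@_k + c@_k = 0 by rewrite -!mcoeffD e mcoeff0.
suff h k : [/\ a@_k = 0, b@_k = 0 & c@_k = 0].
  by split; apply/malgP => k; rewrite mcoeff0; have [] := h k.
move: (hP k) (ek k) (ha k) (hb k) (hc k).
case: (P1 k) (P2 k) (P3 k) => [] [] [] //= _ + h1 h2 h3.
- by rewrite h2 // h3 // !addr0 => ->.
- by rewrite h1 // h3 // addr0 add0r => ->.
- by rewrite h1 // h2 // !add0r => ->.
Qed.

End Span.

(* Bases of both Lie algebras are indexed by [option int]: [Some n] is the     *)
(* vector of index [n] and [None] is the central vector.                       *)
Definition degree (i : option int) : int := odflt 0 i.
Definition neg_index : pred (option int) := fun i => (degree i < 0)%R.
Definition zero_index : pred (option int) := fun i => degree i == 0.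
Definition pos_index : pred (option int) := fun i => (0 < degree i)%R.

Lemma index_trichotomy i : (neg_index i + zero_index i + pos_index i = 1)%N.
Proof. by rewrite /neg_index /zero_index /pos_index; lia. Qed.

Section VirasoroForm.
Variables (F : fieldType) (V : lmodType F) (u : int -> V) (c : V).

Let vf (m n : int) : V := (m - n)%:~R *: u (m + n) +
  ((m ^+ 3 - m)%:~R / 12%:R * (m == - n)%:R) *: c.

Lemma vf_anti m n : vf m n = - vf n m.
Proof.
rewrite /vf opprD -!scaleNr [n + m]addrC -mulrNz opprB; congr (_ + _ *: _).
rewrite eq_sym eqr_oppLR; case: eqP => [->|]; last by rewrite !mulr0 oppr0.
by rewrite !mulr1 -mulNr -mulrNz; congr (_%:~R / _); ring.
Qed.

Lemma vf_ii m : vf m m = 0.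
Proof.
rewrite /vf subrr scale0r add0r.
case: eqP => [e|]; last by rewrite mulr0 scale0r.
have -> : m = 0 by lia.
by rewrite (_ : 0 ^+ 3 - 0 = 0 :> int) // mulr0z !mul0r scale0r.
Qed.

Lemma vf_jacobi l m n :
  (m - n)%:~R *: vf l (m + n) + (n - l)%:~R *: vf m (n + l) +
  (l - m)%:~R *: vf n (l + m) = 0.
Proof.
have ac (a1 b1 a2 b2 a3 b3 : V) : (a1 + b1) + (a2 + b2) + (a3 + b3) =
    (a1 + a2 + a3) + (b1 + b2 + b3) by rewrite (addrACA a1) (addrACA (a1 + a2)).
rewrite /vf !scalerDr !scalerA.
have -> : m + (n + l) = l + (m + n) by ring.
have -> : n + (l + m) = l + (m + n) by ring.
have e1 : (l == - (m + n)) = (l + (m + n) == 0) by rewrite -addr_eq0.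
have e2 : (m == - (n + l)) = (l + (m + n) == 0) by lia.
have e3 : (n == - (l + m)) = (l + (m + n) == 0) by lia.
rewrite e1 e2 e3 ac -!scalerDl.
rewrite -!intrM -!intrD.
have -> : (m - n) * (l - (m + n)) + (n - l) * (m - (n + l)) +
   (l - m) * (n - (l + m)) = 0 by ring.
rewrite scale0r add0r; case: eqP => [e|]; last by rewrite !mulr0 !addr0 scale0r.
rewrite !mulr1 !mulrA -!mulrDl -!intrM -!intrD.
have -> : l = - (m + n) by lia.
have -> : (m - n) * ((- (m + n)) ^+ 3 - - (m + n)) +
  (n - - (m + n)) * (m ^+ 3 - m) + (- (m + n) - m) * (n ^+ 3 - n) = 0 by ring.
by rewrite mul0r scale0r.
Qed.

End VirasoroForm.

Section HeisenbergForm.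
Variables (F : fieldType) (V : lmodType F) (c : V).

Let hf (k l : int) : V := (k%:~R * (k == - l)%:R) *: c.

Lemma hf_anti m n : hf m n = - hf n m.
Proof.
rewrite /hf -scaleNr; congr (_ *: _).
rewrite eq_sym eqr_oppLR; case: eqP => [->|]; last by rewrite !mulr0 oppr0.
by rewrite !mulr1 mulrNz opprK.
Qed.

Lemma hf_ii m : hf m m = 0.
Proof.
rewrite /hf; case: eqP => [e|]; last by rewrite mulr0 scale0r.
have -> : m = 0 by lia.
by rewrite mulr0z mul0r scale0r.
Qed.

End HeisenbergForm.

Section Virasoro.
Variable F : fieldType.

Definition vir_br (i j : option int) : {malg F[option int]} :=
  match i, j with
  | Some m, Some n =>
      (m - n)%:~R *: << Some (m + n) >> +
      ((m ^+ 3 - m)%:~R / 12%:R * (m == - n)%:R) *: << None >>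
  | _, _ => 0
  end.

Lemma vir_br_anti i j : vir_br i j = - vir_br j i.
Proof.
case: i j => [m|] [n|] /=; last by rewrite oppr0.
- exact: (vf_anti (fun n => << Some n >>)).
- by rewrite oppr0.
- by rewrite oppr0.
Qed.

Lemma vir_br_ii i : vir_br i i = 0.
Proof. by case: i => [m|] //; exact: (vf_ii (fun n => << Some n >>)). Qed.

Lemma vir_br_jacobi i j k :
  sc_lie vir_br << i >> (vir_br j k) + sc_lie vir_br << j >> (vir_br k i) +
  sc_lie vir_br << k >> (vir_br i j) = 0.
Proof.
have n0 (l : option int) : vir_br l None = 0 by case: l.
have e l m n : sc_lie vir_br << Some l >> (vir_br (Some m) (Some n)) =
    (m - n)%:~R *: vir_br (Some l) (Some (m + n)).
  by rewrite sc_lieU2 n0 scaler0 addr0.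
have e0 m n : sc_lie vir_br << None >> (vir_br (Some m) (Some n)) = 0.
  by rewrite sc_lieU2 /= !scaler0 addr0.
case: i j k => [l|] [m|] [n|]; last by rewrite !sc_lieU0 !addr0.
- rewrite !e; exact: (vf_jacobi (fun n => << Some n >>)).
all: by rewrite ?n0 ?e0 ?sc_lieU0 ?addr0 ?add0r.
Qed.

Definition vir : Type := {malg F[option int]}.
HB.instance Definition _ := GRing.Lmodule.copy vir {malg F[option int]}.
HB.instance Definition _ := Lmodule_isLie.Build F vir
  (@sc_lie_linearl _ _ vir_br) (@sc_lie_linearr _ _ vir_br)
  (sc_liexx vir_br_ii vir_br_anti) (sc_lie_jacobi vir_br_jacobi).

Definition virL (n : int) : vir := << Some n >>.
Definition virC : vir := << None >>.

Lemma virL_lie m n : lie (virL m) (virL n) =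
  (m - n)%:~R *: virL (m + n) +
  ((m ^+ 3 - m)%:~R / 12%:R * (m == - n)%:R) *: virC.
Proof. exact: sc_lieU. Qed.

Lemma virC_lie n : lie virC (virL n) = 0.
Proof. exact: sc_lieU. Qed.

Lemma vir_span_sub (P : pred (option int)) :
  (forall i j, P i -> P j -> basis_span P (vir_br i j)) ->
  lie_subalgebra (basis_span P : set vir).
Proof.
move=> h; split=> [|a x y|x y]; first exact: basis_span0.
  exact: basis_span_lin.
exact: basis_span_lie.
Qed.

Lemma vir_tri_neg : lie_subalgebra (basis_span neg_index : set vir).
Proof.
apply: vir_span_sub => -[m|] [n|] //; rewrite /neg_index /= => hm hn.
have -> : (m == - n) = false by lia.
rewrite mulr0 scale0r addr0; apply: basis_spanU => /=; lia.
Qed.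

Lemma vir_tri_pos : lie_subalgebra (basis_span pos_index : set vir).
Proof.
apply: vir_span_sub => -[m|] [n|] //; rewrite /pos_index /= => hm hn.
have -> : (m == - n) = false by lia.
rewrite mulr0 scale0r addr0; apply: basis_spanU => /=; lia.
Qed.

Lemma vir_br_zero i j : zero_index i -> zero_index j -> vir_br i j = 0.
Proof.
case: i j => [m|] [n|] // /eqP hm /eqP hn.
have -> : m = 0 := hm; have -> : n = 0 := hn; exact: vir_br_ii.
Qed.

Lemma vir_tri_zero : lie_subalgebra (basis_span zero_index : set vir).
Proof.
by apply: vir_span_sub => i j hi hj; rewrite vir_br_zero //; exact: basis_span0.
Qed.

Definition vir_tri : triangular vir := @Triangular F vir
  (basis_span neg_index) (basis_span zero_index) (basis_span pos_index)
  vir_tri_neg vir_tri_zero vir_tri_pos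
  (fun x y => basis_span_lie0 (x := x) (y := y) vir_br_zero)
  (fun x => basis_decomp x index_trichotomy)
  (fun a b c => basis_direct index_trichotomy).

Definition vir_weight (c h : F) (x : vir) : F :=
  c * mcoeff None x + h * mcoeff (Some (0 : int)) x.

Lemma vir_weight_linear c h : scalar (vir_weight c h).
Proof. by move=> a x y; rewrite /vir_weight !mcoeffD !mcoeffZ; ring. Qed.
HB.instance Definition _ c h :=
  GRing.isLinear.Build F vir F *%R (vir_weight c h) (vir_weight_linear c h).

Definition is_vir_verma (c h : F) (V : lmodType (U vir)) (v : V) :=
  is_verma vir_tri (vir_weight c h) v.

End Virasoro.

Section Heisenberg.
Variable F : fieldType.

Definition hei_br (i j : option int) : {malg F[option int]} :=
  match i, j with
  | Some k, Some l => (k%:~R * (k == - l)%:R) *: << None >>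
  | _, _ => 0
  end.

Lemma hei_br_anti i j : hei_br i j = - hei_br j i.
Proof.
case: i j => [m|] [n|] /=; last by rewrite oppr0.
- exact: hf_anti.
- by rewrite oppr0.
- by rewrite oppr0.
Qed.

Lemma hei_br_ii i : hei_br i i = 0.
Proof. by case: i => [m|] //; exact: hf_ii. Qed.

Lemma hei_br_jacobi i j k :
  sc_lie hei_br << i >> (hei_br j k) + sc_lie hei_br << j >> (hei_br k i) +
  sc_lie hei_br << k >> (hei_br i j) = 0.
Proof.
have n0 (l : option int) : hei_br l None = 0 by case: l.
have e i0 m n : sc_lie hei_br << i0 >> (hei_br (Some m) (Some n)) = 0.
  by rewrite sc_lieU1 n0 scaler0.
case: i j k => [l|] [m|] [n|]; last by rewrite !sc_lieU0 !addr0.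
all: by rewrite ?e ?n0 ?sc_lieU0 ?addr0 ?add0r.
Qed.

Definition hei : Type := {malg F[option int]}.
HB.instance Definition _ := GRing.Lmodule.copy hei {malg F[option int]}.
HB.instance Definition _ := Lmodule_isLie.Build F hei
  (@sc_lie_linearl _ _ hei_br) (@sc_lie_linearr _ _ hei_br)
  (sc_liexx hei_br_ii hei_br_anti) (sc_lie_jacobi hei_br_jacobi).

Definition heiJ (k : int) : hei := << Some k >>.
Definition heiK : hei := << None >>.

Lemma heiJ_lie k l : lie (heiJ k) (heiJ l) = (k%:~R * (k == - l)%:R) *: heiK.
Proof. exact: sc_lieU. Qed.

Lemma heiK_lie k : lie heiK (heiJ k) = 0.
Proof. exact: sc_lieU. Qed.

Lemma hei_span_sub (P : pred (option int)) :
  (forall i j, P i -> P j -> basis_span P (hei_br i j)) ->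
  lie_subalgebra (basis_span P : set hei).
Proof.
move=> h; split=> [|a x y|x y]; first exact: basis_span0.
  exact: basis_span_lin.
exact: basis_span_lie.
Qed.

Lemma hei_tri_neg : lie_subalgebra (basis_span neg_index : set hei).
Proof.
apply: hei_span_sub => -[m|] [n|] //; rewrite /neg_index /= => hm hn.
have -> : (m == - n) = false by lia.
by rewrite mulr0 scale0r; exact: basis_span0.
Qed.

Lemma hei_tri_pos : lie_subalgebra (basis_span pos_index : set hei).
Proof.
apply: hei_span_sub => -[m|] [n|] //; rewrite /pos_index /= => hm hn.
have -> : (m == - n) = false by lia.
by rewrite mulr0 scale0r; exact: basis_span0.
Qed.

Lemma hei_br_zero i j : zero_index i -> zero_index j -> hei_br i j = 0.
Proof.
case: i j => [m|] [n|] // /eqP hm /eqP hn.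
have -> : m = 0 := hm; have -> : n = 0 := hn; exact: hei_br_ii.
Qed.

Lemma hei_tri_zero : lie_subalgebra (basis_span zero_index : set hei).
Proof.
by apply: hei_span_sub => i j hi hj; rewrite hei_br_zero //; exact: basis_span0.
Qed.

Definition hei_tri : triangular hei := @Triangular F hei
  (basis_span neg_index) (basis_span zero_index) (basis_span pos_index)
  hei_tri_neg hei_tri_zero hei_tri_pos
  (fun x y => basis_span_lie0 (x := x) (y := y) hei_br_zero)
  (fun x => basis_decomp x index_trichotomy)
  (fun a b c => basis_direct index_trichotomy).

Definition hei_weight (kappa alpha : F) (x : hei) : F :=
  kappa * mcoeff None x + alpha * mcoeff (Some (0 : int)) x.

Lemma hei_weight_linear kappa alpha : scalar (hei_weight kappa alpha).
Proof. by move=> a x y; rewrite /hei_weight !mcoeffD !mcoeffZ; ring. Qed.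
HB.instance Definition _ kappa alpha := GRing.isLinear.Build F hei F *%R
  (hei_weight kappa alpha) (hei_weight_linear kappa alpha).

Definition is_fock (alpha : F) (M : lmodType (U hei)) (v : M) :=
  is_verma hei_tri (hei_weight 1 alpha) v.

End Heisenberg.

Section IntSums.
Variable V : zmodType.
Implicit Types (f g : int -> V) (s : seq int).
Local Open Scope classical_set_scope.

Local Notation sumZ f := (\sum_(k \in [set: int]) f k).

Definition bounded_supp f := exists N : nat, forall k : int, (N < `|k|)%N -> f k = 0.

Lemma sumZE f s : uniq s -> (forall k, k \notin s -> f k = 0) ->
  sumZ f = \sum_(k <- s) f k.
Proof.
move=> us hs; rewrite (fsbigTE [fset k in s]%fset); last first.
  by move=> k; rewrite !inE; exact: hs.
apply: perm_big; apply: uniq_perm => // k.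
by rewrite !inE.
Qed.

Definition int_range (N : nat) : seq int :=
  [seq (i%:Z - N%:Z) | i <- iota 0 N.*2.+1].

Lemma int_rangeP N k : (k \in int_range N) = (`|k| <= N)%N.
Proof.
apply/mapP/idP => [[i]|h]; first by rewrite mem_iota => hi ->; lia.
by exists (absz (k + N%:Z)); [rewrite mem_iota; lia | lia].
Qed.

Lemma int_range_uniq N : uniq (int_range N).
Proof. by rewrite map_inj_uniq ?iota_uniq // => i j; lia. Qed.

Lemma sumZ_range f (N : nat) : (forall k : int, (N < `|k|)%N -> f k = 0) ->
  sumZ f = \sum_(k <- int_range N) f k.
Proof.
move=> h; apply: sumZE; first exact: int_range_uniq.
by move=> k; rewrite int_rangeP -ltnNge; exact: h.
Qed.

Lemma sumZD f g : bounded_supp f -> bounded_supp g ->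
  sumZ (fun k => f k + g k) = sumZ f + sumZ g.
Proof.
move=> [N hN] [P hP]; pose Q := maxn N P.
have hf k : (Q < `|k|)%N -> f k = 0 by move=> h; apply: hN; lia.
have hg k : (Q < `|k|)%N -> g k = 0 by move=> h; apply: hP; lia.
rewrite (sumZ_range hf) (sumZ_range hg) (@sumZ_range _ Q) ?big_split //.
by move=> k h; rewrite hf // hg // addr0.
Qed.

Lemma eq_sumZ f g : f =1 g -> sumZ f = sumZ g.
Proof. by move=> /funext ->. Qed.

Lemma sumZ_shift f m : sumZ f = sumZ (fun k => f (k + m)).
Proof.
apply: (@reindex_fsbigT _ _ _ _ _ (fun k : int => k + m)).
by exists (fun k => k - m) => k; lia.
Qed.

Lemma sumZ1 f k0 : (forall k, k != k0 -> f k = 0) -> sumZ f = f k0.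
Proof.
move=> h; rewrite (@sumZE _ [:: k0]) ?big_seq1 // => k.
by rewrite inE; exact: h.
Qed.

Lemma bounded_suppD f g : bounded_supp f -> bounded_supp g ->
  bounded_supp (fun k => f k + g k).
Proof.
move=> [N hN] [P hP]; exists (maxn N P) => k h.
by rewrite hN ?hP ?addr0 //; lia.
Qed.

Lemma bounded_supp_shift f m : bounded_supp f -> bounded_supp (fun k => f (k + m)).
Proof. by move=> [N hN]; exists (N + `|m|)%N => k h; apply: hN; lia. Qed.

End IntSums.

Section IntSumsMap.
Variables (V V' : zmodType).
Local Open Scope classical_set_scope.

Lemma sumZ_map (h : V -> V') (f : int -> V) : h 0 = 0 ->
  (forall x y, h (x + y) = h x + h y) -> bounded_supp f ->
  h (\sum_(k \in [set: int]) f k) = \sum_(k \in [set: int]) h (f k).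
Proof.
move=> h0 hD [N hN]; rewrite (sumZ_range hN) (@sumZ_range _ _ N).
  by elim: (int_range N) => [|k s IH]; rewrite ?big_nil ?big_cons // hD IH.
by move=> k hk; rewrite hN.
Qed.

End IntSumsMap.

Section NormalOrder.
Variables (F : fieldType) (W : lmodType F) (J : int -> W -> W).

Definition normal_order (k l : int) (x : W) : W :=
  if (k <= l)%R then J k (J l x) else J l (J k x).

(* [\sum_(k \in A) f k] is the sum of the nonzero [f k] when there are finitely *)
(* many of them, as is the case here on a charged Fock space.                  *)
Definition sugawaraL (n : int) (x : W) : W :=
  2^-1 *: \sum_(k \in [set: int]%classic) normal_order (n - k) k x.

End NormalOrder.

Section SugawaraRelations.
Variables (F : fieldType) (W : lmodType F) (J : int -> W -> W).
Hypothesis char0 : [pchar F] =i pred0.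
Hypothesis J_lin : forall k, linear (J k).
Hypothesis J_comm : forall k l x,
  J k (J l x) = J l (J k x) + (k%:~R * (k == - l)%:R) *: x.
Hypothesis J_nil : forall x, exists N : nat, forall k : int, (N%:Z <= k)%R -> J k x = 0.
Local Notation no := (normal_order J).
Local Notation L := (sugawaraL J).
Local Notation sumZ f := (\sum_(k \in [set: int]%classic) f k).

Lemma natF_neq0 n : (n.+1%:R != 0 :> F).
Proof. by have /pcharf0P -> := char0. Qed.

Lemma JD k x y : J k (x + y) = J k x + J k y.
Proof. by rewrite -[x]scale1r J_lin !scale1r. Qed.
Lemma J0 k : J k 0 = 0.
Proof. by apply: (addrI (J k 0)); rewrite -JD !addr0. Qed.
Lemma JZ k a x : J k (a *: x) = a *: J k x.
Proof. by rewrite -[a *: x]addr0 J_lin J0 addr0. Qed.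

Lemma no_lin k l : linear (no k l).
Proof. by move=> a x y; rewrite /normal_order; case: ifP => _; rewrite !J_lin. Qed.
Lemma noC k l x : no k l x = no l k x.
Proof.
rewrite /normal_order; case: (ltgtP k l) => // ->.
by [].
Qed.

Lemma no_supp n x : bounded_supp (fun k => no (n - k) k x).
Proof.
have [N hN] := J_nil x; exists (N + `|n|)%N => k hk; rewrite /normal_order.
by case: ifP => h; rewrite [J _ x]hN ?J0 //; lia.
Qed.

Lemma sumZscale a (f : int -> W) : bounded_supp f ->
  a *: sumZ f = sumZ (fun k => a *: f k).
Proof.
move=> hf; apply: (sumZ_map (h := fun x => a *: x)) => //.
  exact: scaler0.
exact: scalerDr.
Qed.

Lemma bsZ (c : int -> F) (f : int -> W) : bounded_supp f ->
  bounded_supp (fun k => c k *: f k).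
Proof. by move=> [N hN]; exists N => k /hN ->; rewrite scaler0. Qed.

Lemma L_lin n : linear (L n).
Proof.
move=> a x y; rewrite /sugawaraL.
rewrite scalerA mulrC -scalerA -scalerDr; congr (_ *: _).
rewrite sumZscale; last exact: no_supp.
rewrite -sumZD; [|apply: bsZ; exact: no_supp|exact: no_supp].
by apply: eq_sumZ => k; exact: no_lin.
Qed.
Lemma LD n x y : L n (x + y) = L n x + L n y.
Proof. by rewrite -[x]scale1r L_lin !scale1r. Qed.
Lemma L0 n : L n 0 = 0.
Proof. by apply: (addrI (L n 0)); rewrite -LD !addr0. Qed.
Lemma LZ n a x : L n (a *: x) = a *: L n x.
Proof. by rewrite -[a *: x]addr0 L_lin L0 addr0. Qed.

Lemma no_J a b m x : no a b (J m x) = J m (no a b x) +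
  ((- m%:~R * (b == - m)%:R) *: J a x + (- m%:~R * (a == - m)%:R) *: J b x).
Proof.
have JJ p q : J p (J q (J m x)) = J m (J p (J q x)) +
  ((- m%:~R * (q == - m)%:R) *: J p x + (- m%:~R * (p == - m)%:R) *: J q x).
  have c r : r%:~R * (r == - m)%:R = - m%:~R * (r == - m)%:R :> F.
    by case: eqP => [->|]; rewrite ?mulr0 // mulrNz.
  by rewrite (J_comm q m) JD JZ (J_comm p m) !c -addrA [X in _ + X]addrC.
rewrite /normal_order; case: ifP => _; first exact: JJ.
by rewrite JJ [X in _ + X]addrC.
Qed.

Lemma L_J n m x : L n (J m x) = J m (L n x) - m%:~R *: J (n + m) x.
Proof.
pose g1 k := (- m%:~R * (k == - m)%:R) *: J (n - k) x.
pose g2 k := (- m%:~R * (n - k == - m)%:R) *: J k x.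
have z1 k : k != - m -> g1 k = 0.
  by rewrite /g1 => /negbTE ->; rewrite mulr0 scale0r.
have z2 k : k != n + m -> g2 k = 0.
  move=> h; rewrite /g2; have -> : (n - k == - m) = false by lia.
  by rewrite mulr0 scale0r.
have s1 : bounded_supp g1 by exists `|m|%N => k hk; apply: z1; lia.
have s2 : bounded_supp g2 by exists (absz (n + m)) => k hk; apply: z2; lia.
have s0 : bounded_supp (fun k => J m (no (n - k) k x)).
  by have [N hN] := no_supp n x; exists N => k /hN ->; exact: J0.
rewrite /sugawaraL (eq_sumZ (fun k => no_J (n - k) k m x)).
rewrite sumZD //; last exact: bounded_suppD.
rewrite sumZD // (sumZ1 z1) (sumZ1 z2) /g1 /g2.
have -> : n - - m = n + m by ring.
have -> : (n - (n + m) == - m) by lia.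
rewrite eqxx !mulr1 -sumZ_map ?J0 //; [|exact: JD|exact: no_supp].
rewrite scalerDr JZ -scalerDl scalerA -[in RHS]scaleNr; congr (_ + _ *: _).
by field; exact: (natF_neq0 1).
Qed.

Definition anom (m a b : int) : int :=
  let p := Num.min a b in let q := Num.max a b in
  if m + a + b == 0 then
    - (q * p) * (m + q < p)%R%:Z - p * (m + p) * (q < m + p)%R%:Z
  else 0.

Lemma JJ_no p q x : J p (J q x) =
  no p q x + ((p * (q < p)%R%:Z * (p == - q)%:Z)%:~R : F) *: x.
Proof.
rewrite /normal_order; case: leP => h.
  by rewrite mulr0 mul0r scale0r addr0.
by rewrite J_comm mulr1 intrM; congr (_ + (_ * _) *: _); case: eqP.
Qed.

Lemma L_no m a b x : L m (no a b x) = no a b (L m x) +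
  ((- b%:~R) *: no a (m + b) x + ((- a%:~R) *: no (m + a) b x +
    (anom m a b)%:~R *: x)).
Proof.
have LJJ (p q : int) : (p <= q)%R -> L m (J p (J q x)) = J p (J q (L m x)) +
  ((- q%:~R) *: no p (m + q) x + ((- p%:~R) *: no (m + p) q x +
   (anom m p q)%:~R *: x)).
  move=> pq; rewrite !L_J -!scaleNr JD. rewrite !JZ -addrA; congr (_ + _).
  rewrite ?JZ !JJ_no !scalerDr !scalerA -!addrA; congr (_ + _).
  rewrite [LHS]addrCA; congr (_ + _).
  rewrite -scalerDl -!mulrNz -!intrM -!intrD; congr (_%:~R *: _).
  rewrite /anom (min_idPl pq) (max_idPr pq).
  case: ifP => e.
    have -> : (p == - (m + q)) by lia.
    have -> : (m + p == - q) by lia.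
    by rewrite /=; ring.
  have -> : (p == - (m + q)) = false by lia.
  have -> : (m + p == - q) = false by lia.
  by rewrite /=; ring.
have noE (p q : int) y : (p <= q)%R -> no p q y = J p (J q y).
  by rewrite /normal_order => ->.
have [ab|ba] := leP a b; first by rewrite !(noE _ _ _ ab) LJJ.
have ba' := ltW ba.
rewrite !(noC a b) !(noE _ _ _ ba') LJJ // (noC b) (noC (m + b)).
congr (_ + _); rewrite addrCA; congr (_ + (_ + _)).
by rewrite /anom minC maxC -!addrA [b + a]addrC.
Qed.

Lemma sum_quad (m : int) (n : nat) :
  6 * (\sum_(i <- iota 0 n) i%:Z * (m - i%:Z)) =
  3 * m * n%:Z * (n%:Z - 1) - n%:Z * (n%:Z - 1) * (2 * n%:Z - 1).
Proof.
elim: n => [|n IH]; first by rewrite big_nil; ring.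
have -> : iota 0 n.+1 = iota 0 n ++ [:: n] by rewrite -addn1 iotaD.
have -> : n.+1%:Z = n%:Z + 1 by lia.
by rewrite big_cat big_seq1 mulrDr IH; ring.
Qed.

Lemma sum_anom (m : int) (x : W) :
  (12%:R : F) *: sumZ (fun k => (anom m (- m - k) k)%:~R *: x) =
  (2 * (m ^+ 3 - m))%:~R *: x.
Proof.
have hs (h : int -> int) (p : nat) : injective h ->
   (forall k, k \notin map h (map Posz (iota 0 p)) -> anom m (- m - k) k = 0) ->
   sumZ (fun k => (anom m (- m - k) k)%:~R *: x) =
   ((\sum_(i <- iota 0 p) anom m (- m - h i%:Z) (h i%:Z))%:~R : F) *: x.
  move=> hi hz; rewrite (@sumZE _ _ (map h (map Posz (iota 0 p)))).
  - rewrite !big_map; elim: (iota 0 p) => [|i s IH].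
      by rewrite !big_nil scale0r.
    by rewrite !big_cons IH intrD scalerDl.
  - by rewrite map_inj_uniq // map_inj_uniq ?iota_uniq // => i j [].
  - by move=> k /hz ->; rewrite scale0r.
have memh (h : int -> int) (p : nat) k (i : nat) : (i < p)%N -> k = h i%:Z ->
    k \in map h (map Posz (iota 0 p)).
  by move=> ip ->; apply/map_f/map_f; rewrite mem_iota.
have an k : anom m (- m - k) k =
    k * (- m - k) * (((k < 0) && (- m - k < 0))%R%:Z - ((0 < k) && (0 < - m - k))%R%:Z).
  rewrite /anom; have -> : (m + (- m - k) + k == 0) by lia.
  case: (leP (- m - k) k) => h.
    have -> : (m + k < - m - k)%R = ((0 < k) && (0 < - m - k))%R by lia.
    have -> : (k < m + (- m - k))%R = ((k < 0) && (- m - k < 0))%R by lia.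
    by ring.
  have -> : (m + (- m - k) < k)%R = ((0 < k) && (0 < - m - k))%R by lia.
  have -> : (- m - k < m + k)%R = ((k < 0) && (- m - k < 0))%R by lia.
  by ring.
have twelve S : 6 * S = m ^+ 3 - m -> (12%:R : F) *: (S%:~R *: x) =
    (2 * (m ^+ 3 - m))%:~R *: x.
  move=> <-; rewrite scalerA; congr (_ *: x).
  by rewrite !intrM; ring.
have [m0|m0] := leP 0 m.
  have [p mp] : exists p : nat, m = p%:Z by exists `|m|%N; lia.
  rewrite (hs -%R p); last first.
  - move=> k hk; rewrite an.
    have [hk1|hk1] := boolP ((k < 0) && (- m - k < 0))%R.
      by move/negP: hk; case; apply: (memh _ _ _ `|k|%N); lia.
    have -> : ((0 < k) && (0 < - m - k))%R = false by lia.
    by rewrite subrr mulr0.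
  - exact: oppr_inj.
  apply: twelve; rewrite [X in _ * X](eq_big_seq (fun i : nat => i%:Z * (m - i%:Z))).
    by rewrite sum_quad mp; ring.
  move=> i; rewrite mem_iota => hi; rewrite an.
  have -> : ((0 < - i%:Z) && (0 < - m - - i%:Z))%R = false by lia.
  have [->|i0] := eqVneq i 0%N; first by rewrite oppr0 !mul0r.
  have -> : ((- i%:Z < 0) && (- m - - i%:Z < 0))%R = true by lia.
  by rewrite /=; ring.
have [p mp] : exists p : nat, m = - p%:Z by exists `|m|%N; lia.
rewrite (hs id p); last first.
- move=> k hk; rewrite an.
  have [hk1|hk1] := boolP ((0 < k) && (0 < - m - k))%R.
    by move/negP: hk; case; apply: (memh _ _ _ `|k|%N); lia.
  have -> : ((k < 0) && (- m - k < 0))%R = false by lia.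
  by rewrite subrr mulr0.
- by [].
apply: twelve; rewrite [X in _ * X](eq_big_seq (fun i : nat => i%:Z * (m - - i%:Z))).
  have -> : \sum_(i <- iota 0 p) i%:Z * (m - - i%:Z) =
            - \sum_(i <- iota 0 p) i%:Z * (- m - i%:Z).
    by rewrite -sumrN; apply: eq_bigr => i _; ring.
  by rewrite mulrN sum_quad mp; ring.
move=> i; rewrite mem_iota => hi; rewrite an.
have -> : ((i%:Z < 0) && (- m - i%:Z < 0))%R = false by lia.
have [->|i0] := eqVneq i 0%N; first by rewrite !mul0r.
have -> : ((0 < i%:Z) && (0 < - m - i%:Z))%R = true by lia.
by rewrite /=; ring.
Qed.

Lemma L_L m n x : L m (L n x) = L n (L m x) +
  ((m - n)%:~R *: L (m + n) x +
   ((m ^+ 3 - m)%:~R / 12%:R * (m == - n)%:R) *: x).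
Proof.
have s0 := no_supp n (L m x).
have [N hN] := no_supp (m + n) x.
pose g1 k := (- k%:~R : F) *: no (n - k) (m + k) x.
pose g2 k := (- (n - k)%:~R : F) *: no (m + (n - k)) k x.
pose g3 k := ((anom m (n - k) k)%:~R : F) *: x.
have e1 k : g1 k = (- k%:~R : F) *: no (m + n - (k + m)) (k + m) x.
  by rewrite /g1; congr (_ *: no _ _ _); ring.
have e2 k : g2 k = (- (n - k)%:~R : F) *: no (m + n - k) k x.
  by rewrite /g2; congr (_ *: no _ _ _); ring.
have s1 : bounded_supp g1.
  exists (N + `|m|)%N => k hk; rewrite e1 hN ?scaler0 //; lia.
have s2 : bounded_supp g2.
  by exists N => k hk; rewrite e2 hN ?scaler0.
have s3 : bounded_supp g3.
  exists (`|m| + `|n|)%N => k hk; rewrite /g3 /anom.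
  case: ifP => mn; last by rewrite scale0r.
  rewrite [X in X%:~R](_ : _ = 0) ?scale0r //.
  case: (leP (n - k) k) => h.
    have -> : (m + k < n - k)%R = false by lia.
    have -> : (k < m + (n - k))%R = false by lia.
    by rewrite !mulr0 subrr.
  have -> : (m + (n - k) < k)%R = false by lia.
  have -> : (n - k < m + k)%R = false by lia.
  by rewrite !mulr0 subrr.
rewrite {2}/sugawaraL LZ.
rewrite sumZ_map; [|exact: L0|exact: LD|exact: no_supp].
rewrite (eq_sumZ (fun k => L_no m (n - k) k x)).
rewrite sumZD //; last by apply: bounded_suppD => //; exact: bounded_suppD.
rewrite sumZD //; last exact: bounded_suppD.
rewrite sumZD // scalerDr; congr (_ + _).
rewrite addrA scalerDr; congr (_ + _).
  have -> : sumZ g1 = sumZ (fun k => (- (k - m)%:~R : F) *: no (m + n - k) k x).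
    rewrite [RHS](sumZ_shift _ m); apply: eq_sumZ => k.
    by rewrite e1 addrK.
  rewrite -sumZD //; last first.
    by apply: bsZ; exists N.
  rewrite /sugawaraL scalerA mulrC -scalerA sumZscale; last by exists N.
  congr (_ *: _); apply: eq_sumZ => k.
  have /= := e2 k; rewrite /g2 => -> /=; rewrite -scalerDl; congr (_ *: _).
  by rewrite !intrD !mulrNz; ring.
have [mn|mn] := eqVneq m (- n); last first.
  rewrite (eq_sumZ (g := fun=> 0)).
    by rewrite (sumZ1 (k0 := 0)) // scaler0 mulr0 scale0r.
  move=> k; rewrite /g3 /anom.
  have -> : (m + (n - k) + k == 0) = false by lia.
  by rewrite scale0r.
have nm : n = - m by lia.
have h : (12%:R : F) *: sumZ g3 = (2 * (m ^+ 3 - m))%:~R *: x.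
  by rewrite /g3 nm; exact: sum_anom.
have n12 := natF_neq0 11.
transitivity (2^-1 *: sumZ g3); first by [].
apply: (scalerI n12); rewrite [LHS]scalerA (mulrC 12%:R) -[LHS]scalerA h !scalerA.
rewrite mulr1; congr (_ *: _).
by rewrite intrM; field; rewrite (natF_neq0 1) n12.
Qed.

End SugawaraRelations.

Section FockSpace.
Variables (F : fieldType) (alpha : F) (M : lmodType (U (hei F))) (v : M).

Definition modeJ (k : int) (x : restr M) : restr M :=
  ugen (heiJ F k) *: (x : M).

(* The Sugawara operators, extended linearly to [vir] with [virC] acting as    *)
(* the identity.                                                               *)
Definition sugawara_act (X : vir F) (x : restr M) : restr M :=
  lin_ext (fun i => if i is Some n then sugawaraL modeJ n x else x) X.

Lemma sugawara_act_L n x : sugawara_act (virL F n) x = sugawaraL modeJ n x.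
Proof. exact: lin_extU. Qed.

Lemma sugawara_act_C x : sugawara_act (virC F) x = x.
Proof. exact: lin_extU. Qed.

Hypothesis char0 : [pchar F] =i pred0.
Hypothesis fockM : is_fock alpha v.

Lemma modeJ_lin k : linear (modeJ k).
Proof.
move=> a x y; rewrite /modeJ -restr_comm.
exact: (scalerDr (ugen (heiJ F k)) (a *: x : M) (y : M)).
Qed.

Lemma heiK_central (y : hei F) : lie (heiK F) y = 0.
Proof.
elim/malg_lin_ind: y => [|a k y hy].
  exact: (bilin0r (@lie_linearr F (hei F))).
rewrite lie_linearr hy addr0.
have -> : lie (heiK F) << k >> = 0 by apply: etrans (sc_lieU _ _ _) _.
by rewrite scaler0.
Qed.

Lemma ugen_heiK_comm (u : U (hei F)) : ugen (heiK F) * u = u * ugen (heiK F).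
Proof.
elim/U_rec: u => [a|y|u w hu hw|u w hu hw].
- by rewrite mulr_algl mulr_algr.
- by apply/eqP; rewrite -subr_eq0 -ugen_lie heiK_central linear0.
- by rewrite mulrDl mulrDr hu hw.
- by rewrite mulrA hu -[LHS]mulrA hw mulrA.
Qed.

Lemma heiK_basis : tri_zero (hei_tri F) (heiK F).
Proof. by rewrite -[heiK F]scale1r; exact: basis_spanU. Qed.

Lemma heiJ_pos_basis k : (0 < k)%R -> tri_pos (hei_tri F) (heiJ F k).
Proof. by move=> k0; rewrite -[heiJ F k]scale1r; exact: basis_spanU. Qed.

Lemma fock_K_vac : ugen (heiK F) *: v = v.
Proof.
have [[hz _] _ _] := fockM.
rewrite hz; last exact: heiK_basis.
by rewrite /= /hei_weight !mcoeffU !eqxx /= mulr1 mulr0 addr0 !scale1r.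
Qed.

Lemma fock_Jpos_vac k : (0 < k)%R -> ugen (heiJ F k) *: v = 0.
Proof. by have [[_ hp] _ _] := fockM => /heiJ_pos_basis; exact: hp. Qed.

Lemma fock_K (x : M) : ugen (heiK F) *: x = x.
Proof.
have [_ gen _] := fockM; have [u ->] := gen x.
by rewrite scalerA ugen_heiK_comm -scalerA fock_K_vac.
Qed.

Lemma modeJ_comm k l x : modeJ k (modeJ l x) =
  modeJ l (modeJ k x) + (k%:~R * (k == - l)%:R) *: x.
Proof.
apply/eqP; rewrite addrC -subr_eq; apply/eqP; rewrite /modeJ.
rewrite [LHS](_ : _ = ugen (lie (heiJ F k) (heiJ F l)) *: (x : M)); last first.
  by rewrite ugen_lie scalerBl !scalerA.
by rewrite heiJ_lie linearZ /= restr_scalel fock_K.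
Qed.

Definition locnil (x : restr M) :=
  exists N : nat, forall k : int, (N%:Z <= k)%R -> modeJ k x = 0.

Lemma modeJ_0 k : modeJ k 0 = 0.
Proof. exact: (scaler0 M (ugen (heiJ F k))). Qed.

Lemma locnil_lin a x y : locnil x -> locnil y -> locnil (a *: x + y).
Proof.
move=> [N hN] [P hP]; exists (maxn N P) => k hk.
by rewrite modeJ_lin hN ?hP ?scaler0 ?addr0 //; lia.
Qed.

Lemma locnil0 : locnil 0.
Proof. by exists 0%N => k _; exact: modeJ_0. Qed.

Lemma modeJ_locnil l x : locnil x -> locnil (modeJ l x).
Proof.
move=> [N hN]; exists (N + `|l|.+1)%N => k hk.
rewrite modeJ_comm hN; last by lia.
have -> : (k == - l) = false by lia.
by rewrite modeJ_0 mulr0 scale0r addr0.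
Qed.

Lemma ugen_locnil (y : hei F) (x : M) :
  locnil x -> locnil (ugen y *: x : M).
Proof.
move=> hx; elim/malg_lin_ind: y => [|a k y hy].
  by rewrite linear0 scale0r; exact: locnil0.
rewrite linearP /= scalerDl restr_scalel.
apply: locnil_lin => //; case: k => [k|]; first exact: modeJ_locnil.
by rewrite fock_K.
Qed.

Lemma U_locnil (u : U (hei F)) (x : M) : locnil x -> locnil (u *: x : M).
Proof.
elim/U_rec: u x => [a|y|u w hu hw|u w hu hw] x hx.
- by rewrite -[_ *: _]addr0; apply: locnil_lin => //; exact: locnil0.
- exact: ugen_locnil.
- rewrite scalerDl -[u *: x]scale1r -[1](scale1r (1 : U (hei F))).
  by apply: locnil_lin; [exact: hu|exact: hw].
- by rewrite -scalerA; apply: hu; exact: hw.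
Qed.

Lemma fock_locnil x : locnil x.
Proof.
have [_ gen _] := fockM; have [u ->] := gen x.
apply: U_locnil; exists 1%N => k hk; apply: fock_Jpos_vac; lia.
Qed.

Lemma sugawara_act_linearl x : linear (sugawara_act^~ x).
Proof. by move=> a X Y; exact: linearP. Qed.

Lemma sugawara_act_linearr X : linear (sugawara_act X).
Proof.
move=> a x y; apply: lin_ext_funD => -[n|] //.
exact: (L_lin modeJ_lin fock_locnil).
Qed.

Lemma sugawara_act_lie X Y x : sugawara_act (lie X Y) x =
  sugawara_act X (sugawara_act Y x) - sugawara_act Y (sugawara_act X x).
Proof.
pose D (X Y : vir F) := sugawara_act (lie X Y) x -
  (sugawara_act X (sugawara_act Y x) - sugawara_act Y (sugawara_act X x)).
have comb a (p1 p2 p3 q1 q2 q3 : restr M) :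
    (a *: p1 + q1) - ((a *: p2 + q2) - (a *: p3 + q3)) =
    a *: (p1 - (p2 - p3)) + (q1 - (q2 - q3)).
  have sub (b1 b2 b3 b4 : restr M) : (b1 + b2) - (b3 + b4) = (b1 - b3) + (b2 - b4).
    by rewrite opprD addrACA.
  by rewrite (sub (a *: p2)) (sub (a *: p1)) -!scalerBr.
have Dl a X1 X2 Z : D (a *: X1 + X2) Z = a *: D X1 Z + D X2 Z.
  by rewrite /D lie_linearl !sugawara_act_linearl sugawara_act_linearr comb.
have Dr a X1 X2 Z : D Z (a *: X1 + X2) = a *: D Z X1 + D Z X2.
  by rewrite /D lie_linearr !sugawara_act_linearl sugawara_act_linearr comb.
suff: D X Y = 0 by move/eqP; rewrite subr_eq0 => /eqP.
have D0l Z : D 0 Z = 0.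
  by apply: (addrI (D 0 Z)); rewrite -{1}[D 0 Z]scale1r -Dl scale1r !addr0.
have D0r Z : D Z 0 = 0.
  by apply: (addrI (D Z 0)); rewrite -{1}[D Z 0]scale1r -Dr scale1r !addr0.
elim/malg_lin_ind: X => [|a i X hX]; first exact: D0l.
rewrite Dl hX addr0 (_ : D _ _ = 0) ?scaler0 //; clear X hX.
elim/malg_lin_ind: Y => [|b j Y hY]; first exact: D0r.
rewrite Dr hY addr0 (_ : D _ _ = 0) ?scaler0 //; clear Y hY.
have cC k : lie (virC F) << k >> = 0 by apply: etrans (sc_lieU _ _ _) _.
have Cc k : lie (<< k >> : vir F) (virC F) = 0.
  by apply: etrans (sc_lieU _ _ _) _; case: k.
have act0 z : sugawara_act 0 z = 0 by exact: linear0.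
case: i j => [m|] [n|]; rewrite /D.
- rewrite -/(virL F m) -/(virL F n) virL_lie sugawara_act_linearl.
  rewrite -[_ *: virC F]addr0 sugawara_act_linearl act0 addr0.
  rewrite sugawara_act_C !sugawara_act_L.
  rewrite (L_L char0 modeJ_lin modeJ_comm fock_locnil).
  by rewrite [X in _ - (X - _)]addrC addrK subrr.
- by rewrite -/(virC F) Cc act0 !sugawara_act_C !subrr.
- by rewrite -/(virC F) cC act0 !sugawara_act_C !subrr.
- by rewrite -/(virC F) cC act0 !sugawara_act_C !subrr.
Qed.

Definition sugawara_rep : lieRep (vir F) (restr M) :=
  LieRep sugawara_act_linearl sugawara_act_linearr sugawara_act_lie.

Definition sugawara_module : lmodType (U (vir F)) := Umod sugawara_rep.

Lemma sugawara_moduleL n (x : sugawara_module) :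
  ugen (virL F n) *: x = sugawaraL modeJ n x.
Proof. by rewrite [LHS]Umod_gen; exact: sugawara_act_L. Qed.

Lemma sugawara_moduleC (x : sugawara_module) : ugen (virC F) *: x = x.
Proof. by rewrite [LHS]Umod_gen; exact: sugawara_act_C. Qed.

End FockSpace.

(* Main.v *)
Require Import Defs.
From mathcomp Require Import all_boot all_order all_algebra.
From mathcomp.multinomials Require Import monalg.
From mathcomp Require Import zify.

Import Order.TTheory GRing.Theory.
Local Open Scope ring_scope.

(** The Verma module is the universal module generated by a highest weight
    vector, so existence and uniqueness of the homomorphism both reduce to one
    fact: under the Sugawara action the vacuum is a highest weight vector of
    central charge 1 and conformal weight alpha^2/2.

    The central element acts as the identity by construction.  For n >= 0, every
    normally ordered product :J_{n-k} J_k: applies the mode of larger index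
    first; the two indices sum to n, so that mode has positive index and kills
    the vacuum unless n = k = 0.  Hence L_n kills the vacuum for n > 0, and
    L_0 retains the single term (1/2) J_0 J_0, which acts as alpha^2/2
    ([sugawaraL_pos_vacuum], [sugawaraL_0_vacuum]).  By linearity it suffices to
    check the highest weight conditions on basis vectors
    ([vir_highest_weight_vector]). *)

Lemma basis_span_ind (F : fieldType) (K : choiceType) (Q : pred K)
    (P : {malg F[K]} -> Prop) :
  P 0 -> (forall a k x, Q k -> P x -> P (a *: << k >> + x)) ->
  forall x, basis_span Q x -> P x.
Proof.
move=> P0 PD x Qx; rewrite [x]monalgE big_seq.
elim/big_rec: _ => [//|k y kx Py].
have -> : << x@_k *g k >> = x@_k *: << k >> :> {malg F[K]}.
  by apply/malgP => l; rewrite mcoeffZ !mcoeffU mulrnAr mulr1.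
by apply: PD => //; exact: Qx.
Qed.

Section SugawaraVacuum.
Variables (F : fieldType) (W : lmodType F) (J : int -> W -> W) (w : W).
Hypothesis J_lin : forall k, linear (J k).
Hypothesis J_pos : forall k : int, (0 < k)%R -> J k w = 0.

(** Of two modes whose indices have a nonnegative sum and are not both zero, the
    larger one is positive, and normal ordering applies it first. *)
Lemma normal_order_vacuum (k l : int) :
  (0 <= k + l)%R -> (k, l) != (0, 0) -> normal_order J k l w = 0.
Proof.
rewrite xpair_eqE /normal_order => kl kl0.
by case: ifP => le; rewrite [J _ w]J_pos ?(J0 J_lin) //; lia.
Qed.

Lemma sugawaraL_pos_vacuum (n : int) : (0 < n)%R -> sugawaraL J n w = 0.
Proof.
move=> n0; rewrite /sugawaraL (@sumZ1 _ _ 0) => [|k _].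
all: rewrite normal_order_vacuum ?scaler0 ?xpair_eqE //; lia.
Qed.

Lemma sugawaraL_0_vacuum (a : F) :
  J 0 w = a *: w -> sugawaraL J 0 w = (a ^+ 2 / 2%:R) *: w.
Proof.
move=> Jw; rewrite /sugawaraL (@sumZ1 _ _ 0) => [|k k0].
  by rewrite /normal_order subr0 lexx Jw (JZ J_lin) Jw !scalerA -mulrA mulrC -expr2.
rewrite normal_order_vacuum ?xpair_eqE //; lia.
Qed.

End SugawaraVacuum.

(** The two weight conditions on the Cartan part and the annihilation by the
    positive part are linear in the Lie algebra element, and both parts are spans
    of basis vectors. *)
Lemma vir_highest_weight_vector (F : fieldType) (c h : F)
    (V : lmodType (U (vir F))) (v : V) :
  ugen (virC F) *: v = (c%:A : U (vir F)) *: v ->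
  ugen (virL F 0) *: v = (h%:A : U (vir F)) *: v ->
  (forall n : int, (0 < n)%R -> ugen (virL F n) *: v = 0) ->
  highest_weight_vector (vir_tri F) (vir_weight c h) v.
Proof.
move=> Cv L0v Lv; split.
  apply: (@basis_span_ind F _ zero_index (fun H : vir F =>
    ugen H *: v = ((vir_weight c h H)%:A : U (vir F)) *: v)) => [|a k x k0 IH].
    by rewrite !linear0 !scale0r.
  have kv : ugen (<< k >> : vir F) *: v =
      ((vir_weight c h << k >>)%:A : U (vir F)) *: v.
    case: k k0 => [n /eqP /= ->|_]; rewrite /vir_weight !mcoeffU !eqxx /=.
      by rewrite mulr0 mulr1 add0r L0v.
    by rewrite mulr0 mulr1 addr0 Cv.
  rewrite linearP vir_weight_linear [LHS]scalerDl IH restr_scalel kv.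
  by rewrite -restr_scalel scalerA -[LHS]scalerDl -[in LHS]scalerDl.
apply: (@basis_span_ind F _ pos_index (fun X : vir F =>
  ugen X *: v = 0)) => [|a k x k0 IH].
  by rewrite linear0 scale0r.
rewrite linearP scalerDl IH addr0 restr_scalel.
by case: k k0 => [n /Lv ->|//]; rewrite scaler0.
Qed.

Lemma fock_J0_vac (F : fieldType) (alpha : F) (M : lmodType (U (hei F)))
    (vac : M) (fockM : is_fock alpha vac) :
  modeJ 0 (vac : restr M) = alpha *: (vac : restr M).
Proof.
have [[zero_vac _] _ _] := fockM.
rewrite /modeJ zero_vac; last first.
  by rewrite -[heiJ F 0]scale1r; exact: basis_spanU.
by rewrite /= /hei_weight !mcoeffU !eqxx /= mulr0 mulr1 add0r.
Qed.

Theorem theorem12p7 (F : fieldType) (char0 : [pchar F] =i pred0) (alpha : F)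
  (M : lmodType (U (hei F))) (vac : M) (fockM : is_fock alpha vac)
  (V : lmodType (U (vir F))) (v : V)
  (vermaV : is_vir_verma 1 (alpha ^+ 2 / 2%:R) v) :
  exists f : {linear V -> sugawara_module char0 fockM},
    f v = vac /\
    forall f' : {linear V -> sugawara_module char0 fockM}, f' v = vac -> f' =1 f.
Proof.
have [_ _ universal] := vermaV.
apply: universal; apply: vir_highest_weight_vector.
- by rewrite sugawara_moduleC !scale1r.
- rewrite sugawara_moduleL Umod_const.
  apply: sugawaraL_0_vacuum; [exact: modeJ_lin|exact: fock_Jpos_vac fockM|].
  exact: fock_J0_vac.
- move=> n n0; rewrite sugawara_moduleL.
  apply: sugawaraL_pos_vacuum => //; [exact: modeJ_lin|].
  exact: fock_Jpos_vac fockM.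
Qed.
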